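(* Let $d,m\ge 1$ be integers, let $A_1,\ldots,A_m\in\mathbb{M}_d^+$ and let $p,r\ge 1$ be real numbers. Then there exist unitary matrices $V_1,\ldots,V_d\in\mathbb{M}_d$ such that $$ \left(\sum_{k=1}^m A_k^p\right)^{r}\le \frac{1}{d}\sum_{i=1}^d V_i\left\{\sum_{k=1}^m A_k\right\}^{pr}V_i^*. $$
   Context: $\mathbb{M}_d$ is the space of complex $d\times d$ matrices and $\mathbb{M}_d^+$ its cone of positive semidefinite matrices. Powers of positive semidefinite matrices are defined by the usual spectral functional calculus. The inequality $X\le Y$ between Hermitian matrices is the usual (Loewner) order: $Y-X\in\mathbb{M}_d^+$. *)

(* Defs.v *)
From mathcomp Require Import all_boot all_order all_algebra.
From mathcomp Require Import sesquilinear spectral complex.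
From mathcomp Require Import reals exp.

Set Implicit Arguments.
Unset Strict Implicit.
Unset Printing Implicit Defensive.

Import Order.TTheory GRing.Theory Num.Theory.
Local Open Scope ring_scope.
Local Open Scope complex_scope.
Local Open Scope sesquilinear_scope.

(* [M ^t*] is the conjugate transpose; the order on [R[i]] is partial, so
   [0 <= z] also says that [z] is real. *)
Definition psdmx (R : realType) (d : nat) (A : 'M[R[i]]_d) : Prop :=
  A \is hermsymmx /\ forall x : 'cV[R[i]]_d, 0 <= (x ^t* *m A *m x) 0 0.

Definition loewner_le (R : realType) (d : nat) (X Y : 'M[R[i]]_d) : Prop :=
  psdmx (Y - X).

(* Spectral functional calculus.  The library's spectral theorem
   ([orthomx_spectralP]) reads [A = P^-1 *m diag_mx L *m P] with [P] unitary,
   so [P ^t* = P^-1].  Only meaningful for Hermitian [A]: the eigenvalues are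
   then real and [complex.Re] loses nothing.  The result does not depend on
   the diagonalization, see [hermfunE]. *)
Definition hermfun (R : realType) (d : nat) (f : R -> R) (A : 'M[R[i]]_d) :
    'M[R[i]]_d :=
  (spectralmx A) ^t*
  *m diag_mx (\row_j (f (complex.Re (spectral_diag A 0 j)))%:C)
  *m spectralmx A.

Lemma hermfunE (R : realType) (d : nat) (f : R -> R) (U : 'M[R[i]]_d)
    (l : 'I_d -> R) :
  U \is unitarymx ->
  hermfun f (U ^t* *m diag_mx (\row_j (l j)%:C) *m U)
  = U ^t* *m diag_mx (\row_j (f (l j))%:C) *m U.
Proof.
move=> Uu; set A := U ^t* *m _ *m U.
have Hdiag (g : 'I_d -> R) :
    (diag_mx (\row_j (g j)%:C)) ^t* = diag_mx (\row_j (g j)%:C) :> 'M[R[i]]_d.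
  rewrite tr_diag_mx map_diag_mx; congr diag_mx; apply/rowP=> j; rewrite !mxE.
  by apply: conj_Creal; apply/complex_realP; exists (g j).
have Ah : A \is hermsymmx.
  apply/is_hermitianmxP; rewrite expr0 scale1r /A.
  by rewrite !trmx_mul !map_mxM Hdiag trmxCK mulmxA.
have Asp := orthomx_spectralP (hermitian_normalmx Ah).
have Areal := hermitian_spectral_diag_real Ah.
have Wu := spectral_unitarymx A.
rewrite /hermfun; move: Asp Wu Areal.
set W := spectralmx A; set b := spectral_diag A => Asp Wu breal.
rewrite invmx_unitary // in Asp.
have UU : U ^t* *m U = 1%:M by rewrite -invmx_unitary // mulVmx // unitarymx_unit.
have WW : W ^t* *m W = 1%:M by rewrite -invmx_unitary // mulVmx // unitarymx_unit.
pose M := W *m U ^t*.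
have com : diag_mx b *m M = M *m diag_mx (\row_j (l j)%:C).
  have := congr1 (fun X => W *m X *m U ^t*) Asp; rewrite /A /M !mulmxA.
  rewrite (unitarymxP Wu) mul1mx => <-.
  by rewrite -[LHS]mulmxA (unitarymxP Uu) mulmx1.
have fcom : diag_mx (\row_j (f (complex.Re (b 0 j)))%:C) *m M
          = M *m diag_mx (\row_j (f (l j))%:C).
  apply/matrixP=> i j; move/matrixP/(_ i j): com.
  have bE : (complex.Re (b 0 i))%:C = b 0 i by apply/RRe_real/(mxOverP breal).
  rewrite !mul_diag_mx !mul_mx_diag ![(\matrix_(_, _) _) i j]mxE.
  rewrite ![(\row__ _) 0 _]mxE; move: (M i j) => t.
  have [->|nz] := eqVneq t 0; first by rewrite !mulr0 !mul0r.
  by rewrite -bE [RHS]mulrC => /(mulIf nz)/complexI ->; rewrite mulrC.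
have -> : U ^t* = W ^t* *m M by rewrite /M mulmxA WW mul1mx.
by rewrite -[W ^t* *m M *m _]mulmxA -fcom /M !mulmxA -[_ *m _ *m U]mulmxA UU mulmx1.
Qed.

Definition psdpow (R : realType) (d : nat) (A : 'M[R[i]]_d) (p : R) :
    'M[R[i]]_d :=
  hermfun (fun t => powR t p) A.

(* Main.v *)
Require Import Defs.
From mathcomp Require Import boolp classical_sets topology normedtype sequences.
From mathcomp Require Import all_boot all_order all_algebra.
From mathcomp Require Import sesquilinear spectral complex reals exp.
From mathcomp Require Import fingroup perm cyclic separable cyclotomic.
From mathcomp Require Import ring lra.

(* Write [S] for the sum of the [A_k^p], [Y] for the sum of the [A_k], [s = 1/p],
   [q = p r], and let [U] diagonalize [S] with nonincreasing eigenvalues [sg_j].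

   Following Ando and Zhan, put [T = (S + eps)^(s - 1)], [B = A_k^p] and
   [C = B^(1/2)].  By Loewner-Heinz [C T C <= C (B + eps)^(s - 1) C <= A_k], and
   since [T] is a nonincreasing function of [S], the first [n] diagonal entries of
   [C T C] in the eigenbasis of [S] have at least the sum of those of [T B].
   Summing over [k] and letting [eps] tend to 0, the prefix sums of [sg_j^s] are at
   most those of the diagonal of [U Y U^*].  The tangent inequality for [t^q] and
   summation by parts turn this into: the prefix sums of [sg_j^r] are at most those
   of the diagonal of [H = U Y^q U^*].

   As in the Schur-Horn theorem, two-dimensional rotations then produce a unitary
   [W] such that the diagonal of [W H W^*] dominates [sg^r] entrywise.  Finally,
   extracting the diagonal of a matrix is an average of [d] unitary conjugations by
   diagonal matrices [D_i] of roots of unity, so that [V_i = U^* D_i W U] works. *)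

Set Implicit Arguments.
Unset Strict Implicit.
Unset Printing Implicit Defensive.

Import Order.TTheory GRing.Theory Num.Theory.
Local Open Scope ring_scope.
Local Open Scope complex_scope.
Local Open Scope sesquilinear_scope.

(** * Positive semidefinite matrices and functional calculus *)

Section Adjoint.
Context {R : realType}.
Implicit Types d : nat.

Lemma adj_mulmx m n p (A : 'M[R[i]]_(m, n)) (B : 'M[R[i]]_(n, p)) :
  (A *m B)^t* = B^t* *m A^t*.
Proof. by rewrite trmx_mul map_mxM. Qed.

Lemma adjD m n (A B : 'M[R[i]]_(m, n)) : (A + B)^t* = A^t* + B^t*.
Proof. by rewrite linearD /= map_mxD. Qed.

Lemma adjB m n (A B : 'M[R[i]]_(m, n)) : (A - B)^t* = A^t* - B^t*.
Proof. by rewrite linearB /= map_mxB. Qed.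

Lemma adjE m n (A : 'M[R[i]]_(m, n)) i j : A^t* i j = Num.conj (A j i).
Proof. by rewrite !mxE. Qed.

Lemma adj1 n : (1%:M : 'M[R[i]]_n)^t* = 1%:M.
Proof. by rewrite trmx1 map_mx1. Qed.

Lemma hermsymE d (A : 'M[R[i]]_d) : (A \is hermsymmx) = (A^t* == A).
Proof. by rewrite is_hermitianmxE expr0 scale1r eq_sym. Qed.

Lemma unitary_adjK d (U : 'M[R[i]]_d) : U \is unitarymx -> U^t* *m U = 1%:M.
Proof. by move=> Uu; rewrite -invmx_unitary // mulVmx // unitarymx_unit. Qed.

Lemma conjC_realC (x : R) : Num.conj (x%:C : R[i]) = x%:C.
Proof. by apply: conj_Creal; apply/complex_realP; exists x. Qed.

Lemma hermsym_entry d (A : 'M[R[i]]_d) i j : A^t* = A -> A i j = Num.conj (A j i).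
Proof. by move=> {1}<-; rewrite adjE. Qed.

Lemma hermsym_diag d (A : 'M[R[i]]_d) i :
  A^t* = A -> A i i = (complex.Re (A i i))%:C.
Proof.
move=> /(hermsym_entry i i) e; apply/esym/RRe_real.
by rewrite CrealE -e.
Qed.

End Adjoint.

(** * Quadratic forms and the Loewner order *)

Section Psd.
Context {R : realType} {d : nat}.
Implicit Types (A B X Y : 'M[R[i]]_d) (x : 'cV[R[i]]_d).

Definition qf A x : R[i] := (x^t* *m A *m x) 0 0.

Lemma qfD A B x : qf (A + B) x = qf A x + qf B x.
Proof. by rewrite /qf mulmxDr mulmxDl mxE. Qed.

Lemma qfB A B x : qf (A - B) x = qf A x - qf B x.
Proof. by rewrite /qf mulmxBr mulmxBl !mxE. Qed.

Lemma qf_congr A X x : qf (X^t* *m A *m X) x = qf A (X *m x).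
Proof. by rewrite /qf adj_mulmx !mulmxA. Qed.

Lemma psdmx_adj A : psdmx A -> A^t* = A.
Proof. by case; rewrite hermsymE => /eqP. Qed.

Lemma psdmxE A : A^t* = A -> (forall x, 0 <= qf A x) -> psdmx A.
Proof. by move=> /eqP hA qA; split; rewrite ?hermsymE. Qed.

Lemma psdmx_qf A x : psdmx A -> 0 <= qf A x.
Proof. by case=> _; apply. Qed.

Lemma psdmx0 : psdmx (0 : 'M[R[i]]_d).
Proof.
apply: psdmxE => [|x]; first by rewrite trmx0 map_mx0.
by rewrite /qf mulmx0 mul0mx mxE.
Qed.

Lemma psdmxD A B : psdmx A -> psdmx B -> psdmx (A + B).
Proof.
move=> pA pB; apply: psdmxE => [|x]; first by rewrite adjD (psdmx_adj pA) (psdmx_adj pB).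
by rewrite qfD addr_ge0 ?psdmx_qf.
Qed.

Lemma psdmx_sum (I : Type) (r : seq I) (P : pred I) (F : I -> 'M[R[i]]_d) :
  (forall i, P i -> psdmx (F i)) -> psdmx (\sum_(i <- r | P i) F i).
Proof. by move=> hF; apply: (big_ind (@psdmx R d)) hF; [exact: psdmx0 | exact: psdmxD]. Qed.

Lemma psdmx_congr A X : psdmx A -> psdmx (X^t* *m A *m X).
Proof.
move=> pA; apply: psdmxE => [|x].
  by rewrite !adj_mulmx trmxCK (psdmx_adj pA) mulmxA.
by rewrite qf_congr psdmx_qf.
Qed.

Lemma psdmx_diag A i : psdmx A -> 0 <= complex.Re (A i i).
Proof.
move=> pA; have := psdmx_qf (delta_mx i 0) pA.
rewrite /qf trmx_delta map_delta_mx -rowE -colE !mxE.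
by rewrite (hermsym_diag _ (psdmx_adj pA)) ler0c.
Qed.

Lemma loewner_qf X Y x : loewner_le X Y -> qf X x <= qf Y x.
Proof. by move=> /psdmx_qf; rewrite -subr_ge0 -qfB. Qed.

Lemma loewner_leE X Y : X^t* = X -> Y^t* = Y ->
  (forall x, qf X x <= qf Y x) -> loewner_le X Y.
Proof.
move=> hX hY h; apply: psdmxE => [|x]; first by rewrite adjB hX hY.
by rewrite qfB subr_ge0.
Qed.

Lemma loewner_le_trans Y X (Z : 'M[R[i]]_d) :
  loewner_le X Y -> loewner_le Y Z -> loewner_le X Z.
Proof.
move=> XY YZ; rewrite /loewner_le (_ : Z - X = (Z - Y) + (Y - X)).
  exact: (psdmxD YZ XY).
by rewrite addrA subrK.
Qed.

Lemma loewner_le_congr X Y (Z : 'M[R[i]]_d) :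
  loewner_le X Y -> loewner_le (Z^t* *m X *m Z) (Z^t* *m Y *m Z).
Proof. by move=> XY; rewrite /loewner_le -mulmxBl -mulmxBr; exact: (psdmx_congr Z XY). Qed.

Lemma loewner_le_diag X Y i :
  loewner_le X Y -> complex.Re (X i i) <= complex.Re (Y i i).
Proof.
by move=> /(psdmx_diag i); rewrite !mxE raddfB subr_ge0.
Qed.

Lemma loewner_le_addl X Y (Z : 'M[R[i]]_d) : loewner_le X Y -> loewner_le (X + Z) (Y + Z).
Proof. by rewrite /loewner_le opprD addrACA subrr addr0. Qed.

End Psd.

(** * Unitary diagonalizations with real eigenvalues *)

Section Spectral.
Context {R : realType} {d : nat}.
Implicit Types (U : 'M[R[i]]_d) (f g : 'I_d -> R) (x : 'cV[R[i]]_d).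

Definition rdiag f : 'M[R[i]]_d := diag_mx (\row_j (f j)%:C).

(** Same shape as in [hermfunE]: the eigenvectors are the columns of [U^t*], and a power acts on [f]
    alone. *)
Definition specmx U f : 'M[R[i]]_d := U^t* *m rdiag f *m U.

Definition sqnorm (z : R[i]) : R := complex.Re z ^+ 2 + complex.Im z ^+ 2.

Lemma sqnormE z : (sqnorm z)%:C = Num.conj z * z.
Proof. by rewrite /sqnorm add_Re2_Im2 normCK mulrC. Qed.

Lemma sqnorm_ge0 z : 0 <= sqnorm z.
Proof. by rewrite addr_ge0 ?sqr_ge0. Qed.

Lemma rdiag_adj f : (rdiag f)^t* = rdiag f.
Proof.
rewrite /rdiag tr_diag_mx map_diag_mx; congr diag_mx; apply/rowP=> j.
by rewrite !mxE; apply: conj_Creal; apply/complex_realP; exists (f j).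
Qed.

Lemma rdiagM f g : rdiag f *m rdiag g = rdiag (fun j => f j * g j).
Proof.
apply/matrixP=> i j; rewrite mul_diag_mx !mxE.
by case: (i == j); rewrite ?mulr1n ?mulr0n ?mulr0 // rmorphM.
Qed.

Lemma rdiagB f g : rdiag f - rdiag g = rdiag (fun j => f j - g j).
Proof.
by rewrite /rdiag -linearB; congr diag_mx; apply/rowP=> j; rewrite !mxE rmorphB.
Qed.

Lemma rdiagD f g : rdiag f + rdiag g = rdiag (fun j => f j + g j).
Proof.
by rewrite /rdiag -linearD; congr diag_mx; apply/rowP=> j; rewrite !mxE rmorphD.
Qed.

Lemma rdiag_cst (c : R) : rdiag (fun=> c) = c%:C%:M.
Proof. by apply/matrixP=> i j; rewrite !mxE. Qed.

Lemma eq_specmx U f g : f =1 g -> specmx U f = specmx U g.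
Proof.
move=> fg; rewrite /specmx (_ : rdiag f = rdiag g) //.
by rewrite /rdiag; congr diag_mx; apply/rowP=> j; rewrite !mxE fg.
Qed.

Lemma specmx_adj U f : (specmx U f)^t* = specmx U f.
Proof. by rewrite /specmx !adj_mulmx trmxCK rdiag_adj mulmxA. Qed.

Lemma specmxM U f g : U \is unitarymx ->
  specmx U f *m specmx U g = specmx U (fun j => f j * g j).
Proof.
by move=> Uu; rewrite /specmx -rdiagM !mulmxA mulmxtVK.
Qed.

Lemma specmxB U f g : specmx U f - specmx U g = specmx U (fun j => f j - g j).
Proof. by rewrite /specmx -rdiagB mulmxBr mulmxBl. Qed.

Lemma specmxD U f g : specmx U f + specmx U g = specmx U (fun j => f j + g j).
Proof. by rewrite /specmx -rdiagD mulmxDr mulmxDl. Qed.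

Lemma specmx_cst U (c : R) : U \is unitarymx -> specmx U (fun=> c) = c%:C%:M.
Proof.
by move=> Uu; rewrite /specmx rdiag_cst -mulmxA mul_scalar_mx -scalemxAr
  unitary_adjK // scalemx1.
Qed.

Lemma specmx_qf U f x : qf (specmx U f) x = (\sum_j f j * sqnorm ((U *m x) j 0))%:C.
Proof.
rewrite /specmx qf_congr /qf; set y := U *m x.
rewrite mxE rmorph_sum; apply: eq_bigr => j _ /=.
by rewrite mul_mx_diag !mxE rmorphM /= sqnormE mulrAC mulrC.
Qed.

Lemma psd_specmx U f : (forall j, 0 <= f j) -> psdmx (specmx U f).
Proof.
move=> f0; apply: psdmxE => [|x]; first exact: specmx_adj.
by rewrite specmx_qf ler0c sumr_ge0 // => j _; rewrite mulr_ge0 ?sqnorm_ge0.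
Qed.

Lemma hermsym_specmx (A : 'M[R[i]]_d) : A^t* = A ->
  exists U f, U \is unitarymx /\ A = specmx U f.
Proof.
move=> /eqP; rewrite -hermsymE => hA.
exists (spectralmx A), (fun j => complex.Re (spectral_diag A 0 j)).
have Uu := spectral_unitarymx A; split=> //.
have e : rdiag (fun j => complex.Re (spectral_diag A 0 j)) = diag_mx (spectral_diag A).
  rewrite /rdiag; congr diag_mx; apply/rowP=> j; rewrite !mxE.
  by apply/RRe_real/(mxOverP (hermitian_spectral_diag_real hA)).
have := orthomx_spectralP (hermitian_normalmx hA).
by rewrite invmx_unitary // /specmx e.
Qed.

Lemma specmx_eigenvector U f j : U \is unitarymx ->
  specmx U f *m (U^t* *m delta_mx j 0) = (f j)%:C *: (U^t* *m delta_mx j 0 : 'cV_d).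
Proof.
move=> Uu; rewrite /specmx !mulmxA mulmxtVK // -mulmxA.
rewrite scalemxAr; congr (_ *m _); apply/matrixP=> a b.
rewrite mul_diag_mx !mxE; case: eqP => [->//|_].
by rewrite !mulr0.
Qed.

Lemma specmx_ge0 U f j : U \is unitarymx -> psdmx (specmx U f) -> 0 <= f j.
Proof.
move=> Uu /(psdmx_congr (U^t*)) /(psdmx_diag j).
rewrite trmxCK /specmx !mulmxA (unitarymxP Uu) mul1mx -mulmxA.
by rewrite (unitarymxP Uu) mulmx1 !mxE eqxx.
Qed.

Lemma psdmx_specmx (A : 'M[R[i]]_d) : psdmx A ->
  exists U f, [/\ U \is unitarymx, forall j, 0 <= f j & A = specmx U f].
Proof.
move=> pA; have [U [f [Uu AE]]] := hermsym_specmx (psdmx_adj pA).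
by exists U, f; split=> [//|j|//]; apply: (specmx_ge0 j Uu); rewrite -AE.
Qed.

Lemma psdpow_specmx U f (p : R) : U \is unitarymx ->
  psdpow (specmx U f) p = specmx U (fun j => f j `^ p).
Proof. by move=> Uu; rewrite /psdpow /specmx /rdiag (hermfunE _ f Uu). Qed.

Lemma specmx_perm U f (s : 'S_d) :
  specmx (perm_mx s *m U) (fun j => f (s j)) = specmx U f.
Proof.
suff e : (perm_mx s)^t* *m rdiag (fun j => f (s j)) *m perm_mx s = rdiag f.
  by rewrite /specmx adj_mulmx -e !mulmxA.
apply/matrixP=> a b; rewrite mxE (bigD1 (s^-1%g a)) //= big1 ?addr0 => [|l lN].
  by rewrite mul_mx_diag !mxE permKV eqxx rmorph1 mul1r mulr_natr.
rewrite mul_mx_diag !mxE; case: (s l =P a) => [e|_].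
  by rewrite -e permK eqxx in lN.
by rewrite rmorph0 !mul0r.
Qed.

(** Sorting the list of all indices by decreasing value of [f] gives a tuple that is a permutation
    of the identity tuple. *)
Lemma exists_sorting_perm f : exists s : 'S_d,
  forall i j : 'I_d, (i <= j)%N -> f (s j) <= f (s i).
Proof.
pose e := sort (fun a b => f b <= f a) (enum 'I_d).
have tot : total (fun a b => f b <= f a) by move=> a b; exact: le_total.
have tr : transitive (fun a b => f b <= f a) by move=> b a c ab bc; exact: le_trans bc ab.
have se : size e == d by rewrite size_sort size_enum_ord.
have /tuple_permP[s sE] : perm_eq (Tuple se) [tuple i | i < d].
  by rewrite perm_sort /= map_id enumT.
exists s => i j ij.
have nthE (k : 'I_d) : nth k e k = s k.
  have -> : e = [seq tnth [tuple i | i < d] (s i) | i <- enum 'I_d].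
    by rewrite [LHS]sE.
  by rewrite (nth_map k) ?size_enum_ord // nth_ord_enum tnth_mktuple.
rewrite -(nthE i) -(nthE j) (set_nth_default i) ?(eqP se) //.
have := sort_sorted tot (enum 'I_d); rewrite -/e => so.
apply: (sorted_leq_nth tr (fun a => lexx (f a)) i so) => //; by rewrite inE (eqP se).
Qed.

Lemma psdmx_specmx_sorted (A : 'M[R[i]]_d) : psdmx A ->
  exists U f, [/\ U \is unitarymx, forall j, 0 <= f j,
    forall i j : 'I_d, (i <= j)%N -> f j <= f i & A = specmx U f].
Proof.
move=> /psdmx_specmx[U [f [Uu f0 ->]]]; have [s hs] := exists_sorting_perm f.
exists (perm_mx s *m U), (f \o s); split=> [|j|i j ij|].
- apply: mul_unitarymx Uu; apply/unitarymxP.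
  by rewrite -map_trmx map_perm_mx tr_perm_mx -perm_mxM mulgV perm_mx1.
- exact: f0.
- exact: hs.
- by rewrite -(specmx_perm U f s).
Qed.

End Spectral.

(** * The Loewner-Heinz inequality *)

Section LoewnerHeinz.
Context {R : realType} {d : nat}.
Implicit Types (X Y : R -> 'M[R[i]]_d) (v : 'cV[R[i]]_d) (a b s t : R).

(** An abstraction of the real powers of a positive definite matrix, keeping only the algebra that
    the midpoint and inversion arguments use. *)
Definition hermitian_group X :=
  [/\ forall t, (X t)^t* = X t, forall s t, X s *m X t = X (s + t) & X 0 = 1%:M].

Lemma specmx_powR_group (U : 'M[R[i]]_d) (y : 'I_d -> R) :
  U \is unitarymx -> (forall j, 0 < y j) ->
  hermitian_group (fun t => specmx U (fun j => y j `^ t)).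
Proof.
move=> Uu y0; split=> [t|s t|]; first exact: specmx_adj.
  rewrite (specmxM _ _ Uu); apply: eq_specmx => j.
  by rewrite powRD // (gt_eqF (y0 j)) implybT.
rewrite (@eq_specmx _ _ _ _ (fun=> 1)) => [|j]; last by rewrite powRr0.
by rewrite (specmx_cst _ Uu) rmorph1.
Qed.

Lemma dotcv_ge0 v : 0 <= (v^t* *m v) 0 0.
Proof. by rewrite mxE sumr_ge0 // => l _; rewrite adjE mulrC -normCK exprn_ge0. Qed.

Lemma dotcv_eq0 v : (v^t* *m v) 0 0 = 0 -> v = 0.
Proof.
rewrite mxE => /eqP; rewrite psumr_eq0 => [/allP h|l _]; last first.
  by rewrite adjE mulrC -normCK exprn_ge0.
apply/colP=> l; have := h l (mem_index_enum _).
by rewrite adjE mulrC -normCK sqrf_eq0 normr_eq0 mxE => /eqP.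
Qed.

(** Serves to expand squared norms such as |X (b/2) z - X (a/2) w|^2: one factor moves across by
    self-adjointness and the exponents add. *)
Lemma hermitian_group_dot X s t (p q : 'cV[R[i]]_d) : hermitian_group X ->
  (X (s / 2) *m p)^t* *m (X (t / 2) *m q) = p^t* *m (X ((s + t) / 2) *m q).
Proof.
case=> adjX XD _.
by rewrite adj_mulmx adjX -mulmxA (mulmxA (X _) (X _) q) XD mulrDl.
Qed.

Lemma hermitian_group_qf Y t v : hermitian_group Y ->
  qf (Y t) v = ((Y (t / 2) *m v)^t* *m (Y (t / 2) *m v)) 0 0.
Proof.
case=> adjY YD _; rewrite adj_mulmx adjY !mulmxA -(mulmxA _ (Y _) (Y _)) YD /qf.
by have -> : t / 2 + t / 2 = t by lra.
Qed.

(** A zero of the form would be a vector killed by [Y (t / 2)], which has the inverse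
    [Y (- (t / 2))]. *)
Lemma hermitian_group_qf_gt0 Y t v : hermitian_group Y -> v != 0 -> 0 < qf (Y t) v.
Proof.
move=> gY vN0; rewrite (hermitian_group_qf _ _ gY) lt_neqAle dotcv_ge0 andbT.
apply: contra_neq vN0 => /esym/dotcv_eq0 Yv0; case: gY => _ YD Y0.
by rewrite -[v]mul1mx -Y0 -(addNr (t / 2)) -YD -mulmxA Yv0 mulmx0.
Qed.

(** Here [m] stands for the two equal cross terms of an expanded square; the type is general because
    the values lie in [R[i]], whose order is partial. *)
Lemma le_of_double_le (T : numDomainType) (m p1 p2 q : T) :
  p1 <= q -> p2 <= q -> 0 <= p1 - m - (m - p2) -> m <= q.
Proof.
move=> h1 h2 h; rewrite -(ler_pMn2r (ltn0Sn 1)); apply: le_trans (lerD h1 h2).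
rewrite -subr_ge0 !mulr2n (_ : _ - _ = p1 - m - (m - p2)) //; ring.
Qed.

(* For an eigenpair [X c w = mu Y c w] with [c = (a + b) / 2], and
   [z = Y (a - c) w], expanding [0 <= |X (b/2) z - X (a/2) w|^2] gives
   [2 mu <w, Y a w> <= <z, X b z> + <w, X a w> <= 2 <w, Y a w>]. *)
Lemma loewner_le_midpoint X Y a b : hermitian_group X -> hermitian_group Y ->
  loewner_le (X a) (Y a) -> loewner_le (X b) (Y b) ->
  loewner_le (X ((a + b) / 2)) (Y ((a + b) / 2)).
Proof.
move=> gX gY La Lb; set c := (a + b) / 2.
have [adjX XD _] := gX; have [adjY YD Y0] := gY.
(* [X c <= Y c] amounts to [H <= 1], so it suffices to bound the eigenvalues [mu] of [H] by 1. *)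
pose H := Y (- (c / 2)) *m X c *m Y (- (c / 2)).
have [W [mu [Wu HE]]] : exists W mu, W \is unitarymx /\ H = specmx W mu.
  by apply: hermsym_specmx; rewrite /H !adj_mulmx !adjY adjX mulmxA.
have mu1 j : mu j <= 1.
  have [v [Hv vN0]] : exists v : 'cV_d, H *m v = (mu j)%:C *: v /\ v != 0.
    exists (W^t* *m delta_mx j 0); split; first by rewrite HE; exact: specmx_eigenvector.
    apply/eqP=> /(congr1 (fun v => (W *m v) j 0)).
    rewrite mulmxA (unitarymxP Wu) mul1mx mulmx0 !mxE !eqxx /=.
    by apply/eqP; rewrite oner_eq0.
  have [w [wE vE]] : exists w, w = Y (- (c / 2)) *m v /\ v = Y (c / 2) *m w.
    by exists (Y (- (c / 2)) *m v); rewrite mulmxA YD subrr Y0 mul1mx.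
  have wN0 : w != 0 by apply: contra_neq vN0 => w0; rewrite vE w0 mulmx0.
  have Xw : X c *m w = (mu j)%:C *: (Y c *m w).
    have -> : Y c *m w = Y (c / 2) *m v.
      by rewrite vE mulmxA YD; congr (Y _ *m _); lra.
    by rewrite scalemxAr -Hv /H {}wE !mulmxA YD subrr Y0 mul1mx.
  (* The exponent [a - c] satisfies [2 (a - c) + b = a], so that [qf (Y b) z] and, up to the factor
     [mu j], the cross terms equal [qf (Y a) w]. *)
  have [z zE] : exists z, z = Y (a - c) *m w by exists (Y (a - c) *m w).
  have q0 := hermitian_group_qf_gt0 a gY wN0.
  have zY : qf (Y b) z = qf (Y a) w.
    have e : Y (a - c) *m (Y b *m (Y (a - c) *m w)) = Y a *m w.
      rewrite !mulmxA !YD. by congr (Y _ *m _); rewrite /c; lra.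
    by rewrite /qf zE adj_mulmx adjY -!mulmxA e.
  have zXw : (z^t* *m (X c *m w)) 0 0 = (mu j)%:C * qf (Y a) w.
    have e : Y (a - c) *m (Y c *m w) = Y a *m w by rewrite mulmxA YD subrK.
    by rewrite Xw -scalemxAr mxE zE adj_mulmx adjY /qf -!mulmxA e.
  have wXz : (w^t* *m (X c *m z)) 0 0 = (mu j)%:C * qf (Y a) w.
    have -> : w^t* *m (X c *m z) = (z^t* *m (X c *m w))^t*.
      by rewrite !adj_mulmx adjX trmxCK mulmxA.
    rewrite adjE zXw; apply: conj_Creal; apply: realM; last exact: gtr0_real.
    by apply/complex_realP; exists (mu j).
  have XX s t (p q : 'cV_d) := hermitian_group_dot s t p q gX.
  have := dotcv_ge0 (X (b / 2) *m z - X (a / 2) *m w).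
  rewrite adjB mulmxBl !mulmxBr !XX (addrC b a) -/c.
  have -> : (b + b) / 2 = b by lra.
  have -> : (a + a) / 2 = a by lra.
  have zb : (z^t* *m (X b *m z)) 0 0 <= qf (Y a) w.
    by rewrite -zY mulmxA; exact: loewner_qf.
  have wa : (w^t* *m (X a *m w)) 0 0 <= qf (Y a) w.
    by rewrite mulmxA; exact: loewner_qf.
  have entry (A B C D : 'M[R[i]]_1) :
      (A - B - (C - D)) 0 0 = A 0 0 - B 0 0 - (C 0 0 - D 0 0) by rewrite !mxE.
  rewrite entry zXw wXz.
  move=> /(le_of_double_le zb wa) h.
  by rewrite -lecR -(ler_pM2r q0) rmorph1 mul1r.
rewrite /loewner_le.
have -> : Y c - X c = (Y (c / 2))^t* *m specmx W (fun j => 1 - mu j) *m Y (c / 2).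
  rewrite -specmxB -HE (specmx_cst _ Wu) rmorph1 adjY mulmxBr mulmxBl mulmx1 YD.
  rewrite /H !mulmxA YD subrr Y0 mul1mx -mulmxA YD addNr Y0 mulmx1.
  by congr (Y _ - _); lra.
by apply: psdmx_congr; apply: psd_specmx => j; rewrite subr_ge0.
Qed.

End LoewnerHeinz.

(** * Dyadic approximation and continuity in the exponent *)

Section MidpointClosed.
Import numFieldNormedType.Exports.
Context {R : realType}.

(** Bisection: [c] stays between two points of [Q] whose distance halves each time, so points of [Q]
    come arbitrarily near to [c]. *)
Lemma midpoint_closed_itv (Q : R -> Prop) (a b c : R) :
  (forall s t, Q s -> Q t -> Q ((s + t) / 2)) ->
  (forall t, (forall e, 0 < e -> exists2 s, Q s & `|t - s| < e) -> Q t) ->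
  Q a -> Q b -> a <= c <= b -> Q c.
Proof.
move=> Qmid Qcl Qa Qb /andP[ac cb].
have dyadic n : exists s t, [/\ Q s, Q t, s <= c, c <= t & t - s = (b - a) / 2 ^+ n].
  elim: n => [|n [s [t [Qs Qt sc ct e]]]].
    by exists a, b; split=> //; rewrite expr0 divr1.
  have eS : (b - a) / 2 ^+ n.+1 = (t - s) / 2.
    by rewrite e exprS invfM; lra.
  have [cm|mc] := leP c ((s + t) / 2).
    by exists s, ((s + t) / 2); split=> //; [exact: Qmid | rewrite eS; lra].
  by exists ((s + t) / 2), t; split=> //; [exact: Qmid | exact: ltW | rewrite eS; lra].
apply: Qcl => e e0.
(* With [n] above [(b - a) / e], the gap after [n] halvings is below [e], since [n < 2 ^ n]. *)
have [s [t [Qs _ sc ct st]]] := dyadic (Num.bound ((b - a) / e)).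
exists s => //; rewrite ger0_norm ?subr_ge0 //.
apply: (@le_lt_trans _ _ (t - s)); first by lra.
rewrite st ltr_pdivrMr ?exprn_gt0 // mulrC -ltr_pdivrMr //.
apply: (lt_trans (archi_boundP _)).
  by rewrite divr_ge0 // ?(ltW e0) // subr_ge0 (le_trans ac).
by rewrite -natrX ltr_nat ltn_expl.
Qed.

Lemma ge0_of_continuous_dense (g : R -> R) (t : R) : continuous g ->
  (forall e, 0 < e -> exists2 s, 0 <= g s & `|t - s| < e) -> 0 <= g t.
Proof.
move=> cg h; rewrite leNgt; apply/negP=> gt0.
have near0 := @cvgr_lt _ _ _ _ g (g t) (cg t) 0 gt0.
have [e /= e0 he] := (nbhs_ballP t _).1 (near0 (nbhs_filter t)).
have [s gs ts] := h e e0.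
by have := he s ts; rewrite /= ltNge gs.
Qed.

Lemma continuous_powR_sum (d : nat) (y k : 'I_d -> R) : (forall j, 0 < y j) ->
  continuous (fun t : R => \sum_j y j `^ t * k j).
Proof.
move=> y0; apply: (@continuous_big R 'I_d +%R 0 xpredT add_continuous) => j _ t.
apply: cvgM; last exact: cvg_cst.
rewrite /powR (gt_eqF (y0 j)) /=.
apply: (@continuous_comp R R R (fun t : R => t * ln (y j)) (@expR R) t).
  exact: mulrr_continuous.
exact: continuous_expR.
Qed.

End MidpointClosed.

(** * Inversion and interpolation of the order between powers *)

Section LoewnerHeinzPowers.
Import numFieldNormedType.Exports.
Context {R : realType} {d : nat}.
Implicit Types (X Y : R -> 'M[R[i]]_d) (v : 'cV[R[i]]_d) (a b s t : R).

(** With [w = Y (- t) v], expanding 0 <= |X (t/2) w - X (-t/2) v|^2 gives 2 <v, w> <= <w, X t w> +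
    <v, X (-t) v>, while <w, X t w> <= <w, Y t w> = <v, w>. *)
Lemma loewner_le_inv X Y t : hermitian_group X -> hermitian_group Y ->
  loewner_le (X t) (Y t) -> loewner_le (Y (- t)) (X (- t)).
Proof.
move=> gX gY L; have [adjX _ X0] := gX; have [adjY YD Y0] := gY.
apply: loewner_leE => // v.
have [w wE] : exists w, w = Y (- t) *m v by exists (Y (- t) *m v).
have wv : (w^t* *m v) 0 0 = qf (Y (- t)) v by rewrite wE adj_mulmx adjY.
have vw : (v^t* *m w) 0 0 = qf (Y (- t)) v by rewrite wE mulmxA.
have wYw : qf (Y t) w = qf (Y (- t)) v.
  by rewrite -vw /qf -mulmxA {2}wE (mulmxA (Y _)) YD subrr Y0 mul1mx wv vw.
have := dotcv_ge0 (X (t / 2) *m w - X (- t / 2) *m v).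
have XX s s' (p q : 'cV_d) := hermitian_group_dot s s' p q gX.
have e0 : (t + - t) / 2 = 0 by lra.
have e1 : (- t + t) / 2 = 0 by lra.
rewrite adjB mulmxBl !mulmxBr !XX e0 e1 X0 !mul1mx.
have -> : (t + t) / 2 = t by lra.
have -> : (- t + - t) / 2 = - t by lra.
have entry (A B C D : 'M[R[i]]_1) :
    (A - B - (C - D)) 0 0 = A 0 0 - B 0 0 - (C 0 0 - D 0 0) by rewrite !mxE.
rewrite entry wv vw !mulmxA -/(qf (X t) w) -/(qf (X (- t)) v) => h.
have h1 := loewner_qf w L; rewrite wYw in h1.
rewrite -subr_ge0.
have -> : qf (X (- t)) v - qf (Y (- t)) v =
    (qf (X t) w - qf (Y (- t)) v - (qf (Y (- t)) v - qf (X (- t)) v)) +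
    (qf (Y (- t)) v - qf (X t) w) by ring.
by rewrite addr_ge0 // subr_ge0.
Qed.

(** The exponents for which the order holds are closed under midpoints, and topologically closed
    because each quadratic form is continuous in the exponent. *)
Lemma loewner_le_powR (P U : 'M[R[i]]_d) (x y : 'I_d -> R) a b c :
  P \is unitarymx -> U \is unitarymx -> (forall j, 0 < x j) -> (forall j, 0 < y j) ->
  a <= c <= b ->
  loewner_le (specmx P (fun j => x j `^ a)) (specmx U (fun j => y j `^ a)) ->
  loewner_le (specmx P (fun j => x j `^ b)) (specmx U (fun j => y j `^ b)) ->
  loewner_le (specmx P (fun j => x j `^ c)) (specmx U (fun j => y j `^ c)).
Proof.
move=> Pu Uu x0 y0 acb La Lb.
have gX := specmx_powR_group Pu x0; have gY := specmx_powR_group Uu y0.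
pose Q t := loewner_le (specmx P (fun j => x j `^ t)) (specmx U (fun j => y j `^ t)).
have Qmid s t : Q s -> Q t -> Q ((s + t) / 2).
  by move=> Qs Qt; exact: (loewner_le_midpoint gX gY Qs Qt).
suff Qcl t : (forall e, 0 < e -> exists2 s, Q s & `|t - s| < e) -> Q t.
  exact: (@midpoint_closed_itv _ Q a b c Qmid Qcl La Lb acb).
move=> ht.
apply: loewner_leE => [||v]; [exact: specmx_adj | exact: specmx_adj |].
rewrite !specmx_qf lecR -subr_ge0.
pose G (V : 'M[R[i]]_d) (z : 'I_d -> R) (s : R) :=
  \sum_j z j `^ s * sqnorm ((V *m v) j 0).
apply: (@ge0_of_continuous_dense _ (fun s => G U y s - G P x s)) => [s|e e0].
  by apply: cvgB; exact: continuous_powR_sum.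
have [s Qs ts] := ht e e0; exists s => //.
by rewrite subr_ge0; have := loewner_qf v Qs; rewrite !specmx_qf lecR.
Qed.

(** Inversion settles the exponent -1, both sides are the identity at 0, and interpolation fills the
    range between. *)
Lemma loewner_heinz_neg (P U : 'M[R[i]]_d) (x y : 'I_d -> R) q :
  P \is unitarymx -> U \is unitarymx -> (forall j, 0 < x j) -> (forall j, 0 < y j) ->
  -1 <= q <= 0 -> loewner_le (specmx P x) (specmx U y) ->
  loewner_le (specmx U (fun j => y j `^ q)) (specmx P (fun j => x j `^ q)).
Proof.
move=> Pu Uu x0 y0 hq L.
have gX := specmx_powR_group Pu x0; have gY := specmx_powR_group Uu y0.
apply: (loewner_le_powR Uu Pu y0 x0 hq).
  apply: (loewner_le_inv gX gY).
  rewrite (@eq_specmx _ _ _ _ x) => [|j]; last by rewrite powRr1 ?ltW.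
  by rewrite (@eq_specmx _ _ U _ y) => [|j]; last by rewrite powRr1 ?ltW.
have [_ _ ->] := gX; have [_ _ ->] := gY.
by rewrite /loewner_le subrr; exact: psdmx0.
Qed.

End LoewnerHeinzPowers.

(** * Diagonals of unitary conjugates *)

Section Horn.
Context {R : realType} {d : nat}.
Implicit Types (H W : 'M[R[i]]_d) (v : 'cV[R[i]]_d).

Lemma ReD (x y : R[i]) : complex.Re (x + y) = complex.Re x + complex.Re y.
Proof. by case: x y => [a b] [a' b']. Qed.

Lemma ReN (x : R[i]) : complex.Re (- x) = - complex.Re x.
Proof. by case: x. Qed.

Lemma ReZ (a : R) (x : R[i]) : complex.Re (a%:C * x) = a * complex.Re x.
Proof. by case: x => u v /=; rewrite mul0r subr0. Qed.

Lemma Re_conj (x : R[i]) : complex.Re (Num.conj x) = complex.Re x.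
Proof. by case: x. Qed.

Lemma exists_sqnorm_Re0 (z : R[i]) (b : R) : 0 <= b ->
  exists2 w : R[i], sqnorm w = b & complex.Re (w * z) = 0.
Proof.
move=> b0; case: z => x y.
have [xy0|xyN0] := eqVneq (x ^+ 2 + y ^+ 2) 0.
  have [/eqP x0 /eqP y0] : x == 0 /\ y == 0.
    by move/eqP: xy0; rewrite paddr_eq0 ?sqr_ge0 // !sqrf_eq0 => /andP.
  exists (Num.sqrt b)%:C; last by rewrite x0 y0 /= !mulr0 subr0.
  by rewrite /sqnorm /= expr0n addr0 sqr_sqrtr.
have sq0 : 0 <= b / (x ^+ 2 + y ^+ 2) by rewrite divr_ge0 // addr_ge0 ?sqr_ge0.
(* The witness below is [s] times the imaginary unit times the conjugate of [z], so its product with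
   [z] is purely imaginary. *)
pose s := Num.sqrt (b / (x ^+ 2 + y ^+ 2)).
exists (Complex (s * y) (s * x)); last by rewrite /=; ring.
rewrite /sqnorm /= !exprMn -mulrDr (addrC (y ^+ 2)) /s sqr_sqrtr //.
by rewrite divfK.
Qed.

(** For a unit vector [v], the reflection in the hyperplane orthogonal to [v]; being Hermitian, it
    is then its own inverse. *)
Definition householder v : 'M[R[i]]_d := 1%:M - 2%:R *: (v *m v^t*).

Lemma householder_adj v : (householder v)^t* = householder v.
Proof.
rewrite /householder adjB adj1; congr (_ - _).
apply/matrixP=> a b; rewrite adjE !mxE rmorphM rmorph_nat; congr (_ * _).
rewrite rmorph_sum; apply: eq_bigr => k _; rewrite rmorphM !mxE mulrC; congr (_ * _).
exact: conjCK.
Qed.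

Lemma householder_unitary v : v^t* *m v = 1%:M -> householder v \is unitarymx.
Proof.
move=> v1; apply/unitarymxP; rewrite householder_adj /householder.
set K := v *m v^t*.
have KK : K *m K = K by rewrite /K mulmxA -(mulmxA v) v1 mulmx1.
rewrite mulmxBl mul1mx mulmxBr mulmx1 -scalemxAl -scalemxAr KK scalerA.
apply/matrixP=> a b; rewrite !mxE; ring.
Qed.

(** With [K = v v^*], expand [(1 - 2 K) H (1 - 2 K)]: the diagonal entries of the cross terms are
    conjugate, and [K H K] is [qf H v] times [K]. *)
Lemma householder_diag v H l : H^t* = H ->
  complex.Re ((householder v *m H *m (householder v)^t*) l l) =
  complex.Re (H l l) - 4 * complex.Re (Num.conj (v l 0) * (H *m v) l 0)
  + 4 * sqnorm (v l 0) * complex.Re (qf H v).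
Proof.
move=> hH; rewrite householder_adj /householder.
set K := v *m v^t*.
have KH : (K *m H) l l = v l 0 * Num.conj ((H *m v) l 0).
  rewrite /K -mulmxA mxE big_ord1; congr (_ * _).
  by rewrite -{1}hH -adj_mulmx adjE.
have HK : (H *m K) l l = Num.conj (v l 0) * (H *m v) l 0.
  by rewrite /K mulmxA mxE big_ord1 adjE mulrC.
have KHK : (K *m H *m K) l l = (sqnorm (v l 0))%:C * qf H v.
  have qE : v^t* *m (H *m v) = (qf H v)%:M by rewrite mulmxA [LHS]mx11_scalar.
  rewrite /K -!mulmxA (mulmxA H).
  rewrite (mulmxA _ (H *m v)) qE mul_scalar_mx -scalemxAr mxE mxE big_ord1 adjE.
  by rewrite sqnormE mulrC (mulrC (v l 0)).
have -> : ((1%:M - 2%:R *: K) *m H *m (1%:M - 2%:R *: K)) l l =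
    H l l - 2%:R * (K *m H) l l - 2%:R * (H *m K) l l + 4%:R * (K *m H *m K) l l.
  rewrite mulmxBl mul1mx mulmxBr mulmx1 mulmxBl -!scalemxAl -!scalemxAr.
  rewrite !mxE; ring.
rewrite KH HK KHK.
have nC (n : nat) : n%:R = (n%:R : R)%:C :> R[i] by rewrite rmorph_nat.
rewrite (nC 2) (nC 4) !ReD !ReN !ReZ.
have -> : complex.Re (v l 0 * Num.conj ((H *m v) l 0)) =
          complex.Re (Num.conj (v l 0) * (H *m v) l 0).
  by rewrite -Re_conj rmorphM; congr (complex.Re (_ * _)); exact: conjCK.
by rewrite mulrA; lra.
Qed.

(* A Householder reflection supported on the coordinates [i] and [j], the phase of
   its [j]-th coordinate being chosen so that [H i j] does not contribute. *)
Lemma unitary_transfer H (i j : 'I_d) (t : R) : H^t* = H -> i != j -> 0 <= t <= 1 ->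
  exists2 W, W \is unitarymx & forall l,
    complex.Re ((W *m H *m W^t*) l l) =
    if l == i then t * complex.Re (H i i) + (1 - t) * complex.Re (H j j)
    else if l == j then (1 - t) * complex.Re (H i i) + t * complex.Re (H j j)
    else complex.Re (H l l).
Proof.
move=> hH ij /andP[t0 t1]; pose s := Num.sqrt t.
have ss : s ^+ 2 = t by rewrite sqr_sqrtr.
have s0 : 0 <= s := sqrtr_ge0 t.
have s1 : s <= 1 by rewrite /s -sqrtr1 ler_sqrt // ltr01.
(* These weights make [s] and [- s] the diagonal entries of the reflection at [i] and [j], and
   [s ^+ 2 = t]. *)
pose a := Num.sqrt ((1 - s) / 2).
have aa : a ^+ 2 = (1 - s) / 2 by rewrite sqr_sqrtr //; lra.
have [b bb bz] : exists2 b : R[i], sqnorm b = (1 + s) / 2 & complex.Re (b * H i j) = 0.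
  by apply: exists_sqnorm_Re0; lra.
have ji : j != i by rewrite eq_sym.
pose v : 'cV[R[i]]_d := \col_l (if l == i then a%:C else if l == j then b else 0).
have vi : v i 0 = a%:C by rewrite mxE eqxx.
have vj : v j 0 = b by rewrite mxE eqxx (negbTE ji).
have v0 l : l != i -> l != j -> v l 0 = 0 by rewrite mxE => /negbTE-> /negbTE->.
have sumv (F : 'I_d -> R[i]) : (forall l, v l 0 = 0 -> F l = 0) ->
    \sum_l F l = F i + F j.
  move=> F0; rewrite (bigD1 i) //= (bigD1 j) //= big1 ?addr0 // => l /andP[li lj].
  by apply/F0/v0.
have conja : Num.conj (a%:C : R[i]) = a%:C by exact: conjC_realC.
have v1 : v^t* *m v = 1%:M.
  rewrite [LHS]mx11_scalar mxE; congr (_%:M).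
  rewrite sumv => [|l vl]; last by rewrite vl mulr0.
  rewrite !adjE vi vj conja -sqnormE bb -rmorphM -rmorphD -expr2 aa.
  rewrite -[RHS](rmorph1 (real_complex R)).
  by congr (_%:C); lra.
have Hv l : (H *m v) l 0 = a%:C * H l i + b * H l j.
  rewrite mxE sumv => [|k vk]; last by rewrite vk mulr0.
  by rewrite vi vj mulrC (mulrC (H l j)).
have zi : complex.Re (Num.conj (v i 0) * (H *m v) i 0) = (1 - s) / 2 * complex.Re (H i i).
  by rewrite vi conja Hv mulrDr ReD !ReZ bz mulr0 addr0 mulrA -expr2 aa.
have zj : complex.Re (Num.conj (v j 0) * (H *m v) j 0) = (1 + s) / 2 * complex.Re (H j j).
  rewrite vj Hv mulrDr ReD mulrCA ReZ mulrA -sqnormE ReZ bb.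
  rewrite (hermsym_entry j i hH) -rmorphM Re_conj bz mulr0 add0r //.
have q : complex.Re (qf H v) =
    (1 - s) / 2 * complex.Re (H i i) + (1 + s) / 2 * complex.Re (H j j).
  rewrite /qf -mulmxA mxE sumv => [|l vl].
    by rewrite ReD !adjE zi zj.
  by rewrite adjE vl rmorph0 mul0r.
exists (householder v); first exact: householder_unitary.
move=> l; rewrite (householder_diag _ _ hH) q.
case: (l =P i) => [->|/eqP li].
  by rewrite zi vi /sqnorm /= expr0n addr0 aa -ss; field.
case: (l =P j) => [->|/eqP lj].
  by rewrite zj vj bb -ss; field.
by rewrite (v0 l) // /sqnorm rmorph0 mul0r /= !expr0n addr0 !mulr0 mul0r subr0 addr0.
Qed.

(** The weight in [unitary_transfer] is [t = 1 - e / (hj - hi)]; if the two diagonal entries agree,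
    then [e = 0] and the identity serves. *)
Lemma unitary_diag_shift H (i j : 'I_d) (e : R) : H^t* = H -> i != j -> 0 <= e ->
  e <= complex.Re (H j j) - complex.Re (H i i) ->
  exists2 W, W \is unitarymx & forall l,
    complex.Re ((W *m H *m W^t*) l l) =
    complex.Re (H l l) + (if l == i then e else if l == j then - e else 0).
Proof.
move=> hH ij e0; set hi := complex.Re (H i i); set hj := complex.Re (H j j) => eh.
have [h0|hN0] := eqVneq (hj - hi) 0.
  exists 1%:M => [|l]; first by apply/unitarymxP; rewrite adj1 mulmx1.
  have -> : e = 0 by apply/eqP; rewrite eq_le e0 -h0 eh.
  by rewrite adj1 mul1mx mulmx1 oppr0 !if_same addr0.
have hp : 0 < hj - hi by rewrite lt_neqAle eq_sym hN0 (le_trans e0).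
have t01 : 0 <= 1 - e / (hj - hi) <= 1.
  by rewrite subr_ge0 ler_pdivrMr // mul1r eh gerBl divr_ge0 // ltW.
have [W Wu WE] := unitary_transfer hH ij t01; exists W => // l; rewrite WE -/hi -/hj.
case: (l =P i) => [->|_]; first by rewrite -/hi; field.
by case: (l =P j) => [->|_]; [rewrite -/hj; field | rewrite addr0].
Qed.

(* A first deficit [h i < xi i] forces an earlier excess [xi j < h j]; moving the
   smaller of the two gaps from [j] to [i] makes one more entry equal to [xi]. *)
Lemma horn_dominate (xi : 'I_d -> R) H :
  (forall i j : 'I_d, (i <= j)%N -> xi j <= xi i) -> H^t* = H ->
  (forall k : nat, \sum_(l < d | (l < k)%N) xi l <=
                   \sum_(l < d | (l < k)%N) complex.Re (H l l)) ->
  exists2 W, W \is unitarymx &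
    forall l, xi l <= complex.Re ((W *m H *m W^t*) l l).
Proof.
move=> xi_dec; pose D G := [set l | complex.Re ((G : 'M[R[i]]_d) l l) != xi l].
have [n] := ubnP #|D H|; elim: n H => // n IHn H; rewrite ltnS => Dn hH le_prefix.
pose h l := complex.Re (H l l).
have [[i hi]|allle] := pselect (exists i, h i < xi i); last first.
  exists 1%:M => [|l]; first by apply/unitarymxP; rewrite adj1 mulmx1.
  rewrite adj1 mul1mx mulmx1 leNgt; apply/negP=> hl; apply: allle; by exists l.
have [{hi}i hi imin] := @arg_minnP _ i (fun i => h i < xi i) (fun i => i : nat) hi.
have lti (l : 'I_d) : (l < i)%N -> xi l <= h l.
  by move=> li; rewrite leNgt; apply/negP=> /imin; rewrite leqNgt li.
have [j ji hj] : exists2 j : 'I_d, (j < i)%N & xi j < h j.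
  (* Otherwise no entry before [i] exceeds [xi], and the deficit at [i] contradicts the prefix
     inequality up to and including [i]. *)
  apply: contrapT => noj; have := le_prefix i.+1.
  rewrite (bigD1 i) //= [X in _ <= X](bigD1 i) //= leNgt => /negP; apply.
  rewrite ltr_leD // ler_sum // => l /andP[li lNi]; rewrite leNgt; apply/negP=> hl.
  by apply: noj; exists l; rewrite // ltn_neqAle -ltnS li andbT.
have ij : i != j by apply: contraTneq ji => ->; rewrite ltnn.
pose e := Num.min (h j - xi j) (xi i - h i).
have e0 : 0 < e by rewrite lt_min !subr_gt0 hj hi.
have ej : e <= h j - xi j by rewrite ge_min lexx.
have ei : e <= xi i - h i by rewrite ge_min lexx orbT.
have xij : xi i <= xi j by apply: xi_dec; exact: ltnW.
have [|W Wu WE] := @unitary_diag_shift H i j e hH ij (ltW e0).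
  by rewrite -/(h i) -/(h j); lra.
pose G := W *m H *m W^t*.
have hG : G^t* = G by rewrite /G !adj_mulmx trmxCK hH mulmxA.
have ji' : j == i = false by rewrite eq_sym (negbTE ij).
have Gi : complex.Re (G i i) = h i + e by rewrite WE eqxx.
have Gj : complex.Re (G j j) = h j - e by rewrite WE ji' eqxx.
have Gl l : l != i -> l != j -> complex.Re (G l l) = h l.
  by move=> /negbTE li /negbTE lj; rewrite WE li lj addr0.
have [||V Vu VE] := IHn G _ hG.
- apply: leq_trans Dn; apply: proper_card; apply/properP; split.
    apply/subsetP=> l; rewrite !inE; have [->|li] := eqVneq l i.
      by move=> _; rewrite -/(h i) lt_eqF.
    have [->|lj] := eqVneq l j; first by move=> _; rewrite -/(h j) gt_eqF.
    by rewrite Gl.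
  have [ee|ee] := leP (h j - xi j) (xi i - h i).
    exists j; first by rewrite inE -/(h j) gt_eqF.
    rewrite inE negbK Gj /e; by move: ee; rewrite minEle => ->; rewrite subKr.
  exists i; first by rewrite inE -/(h i) lt_eqF.
  rewrite inE negbK Gi /e; by rewrite minElt ltNge (ltW ee) /= addrC subrK.
(* A prefix without [i] can change only at [j], whose entry stays at least [xi j]; one with [i] also
   contains [j] and keeps its sum. *)
- move=> k; have [ik|ki] := ltnP i k; last first.
    apply: ler_sum => l lk; have li : (l < i)%N := leq_trans lk ki.
    have [->|lj] := eqVneq l j; first by rewrite Gj; lra.
    by rewrite Gl ?lti //; apply: contraTneq li => ->; rewrite ltnn.
  apply: (le_trans (le_prefix k)).
  have jk : (j < k)%N := ltn_trans ji ik.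
  rewrite (bigD1 i) //= (bigD1 j) /=; last by rewrite jk eq_sym.
  rewrite [X in _ <= X](bigD1 i) //= [X in _ <= _ + X](bigD1 j) /=; last by rewrite jk eq_sym.
  rewrite Gi Gj !addrA -/(h i) -/(h j).
  have -> : h i + e + h j - e = h i + h j by lra.
  rewrite lerD2l ler_sum // => l /andP[/andP[_ li] lj].
  by rewrite Gl.
exists (V *m W) => [|l]; first exact: mul_unitarymx.
by have := VE l; rewrite /G !mulmxA adj_mulmx !mulmxA.
Qed.

End Horn.

(** * Pinching *)

(** In characteristic 0, ['X^n - 1] is separable, so it has [n] distinct roots, and [n] distinct
    [n]-th roots of unity include a primitive one. *)
Lemma exists_prim_root (C : numClosedFieldType) (n : nat) :
  (0 < n)%N -> exists z : C, n.-primitive_root z.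
Proof.
move=> n0; pose p : {poly C} := 'X^n - 1; have [r pE] := closed_field_poly_normal p.
rewrite (monicP _) ?monicXnsubC // scale1r in pE.
have rn1 : all n.-unity_root r by apply/allP=> z; rewrite -root_prod_XsubC -pE.
have sz_r : (n < (size r).+1)%N by rewrite -(size_prod_XsubC r id) -pE size_XnsubC.
have [|z _ zn] := hasP (has_prim_root n0 rn1 _ sz_r); last by exists z.
by rewrite -separable_prod_XsubC -pE separable_Xn_sub_1 // pnatr_eq0 -lt0n.
Qed.

(** Orthogonality of the characters of a cyclic group, as a geometric sum of ratio
    [w = z^(a - b)]. *)
Lemma sum_prim_root_expr (C : numClosedFieldType) (n : nat) (z : C) (a b : 'I_n) :
  n.-primitive_root z ->
  \sum_(i < n) z ^+ (i * a) * Num.conj (z ^+ (i * b)) = n%:R *+ (a == b).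
Proof.
move=> zn; have n0 := prim_order_gt0 zn.
have z1 : `|z| = 1.
  apply/eqP; rewrite -(@pexpr_eq1 _ _ n) //; apply/eqP.
  by rewrite -normrX (prim_expr_order zn) normr1.
have zc : z * Num.conj z = 1 by rewrite -normCK z1 expr1n.
have zN0 : z != 0 by rewrite -normr_eq0 z1 oner_eq0.
have conjz k : Num.conj (z ^+ k) = (z ^+ k)^-1.
  rewrite rmorphXn -exprVn; congr (_ ^+ k).
  by apply: (mulfI zN0); rewrite zc divff.
pose w := z ^+ a / z ^+ b.
have wE (i : 'I_n) : z ^+ (i * a) * Num.conj (z ^+ (i * b)) = w ^+ i.
  by rewrite conjz !(mulnC i) !exprM -exprVn -exprMn.
under eq_bigr => i _ do rewrite wE.
have [ab|ab] := eqVneq a b.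
  rewrite /w ab divff ?expf_neq0 //.
  by under eq_bigr => i _ do rewrite expr1n; rewrite sumr_const card_ord.
have w1 : w - 1 != 0.
  rewrite subr_eq0; apply: contraNneq ab => /(congr1 ( *%R^~ (z ^+ b))).
  rewrite /w divfK ?expf_neq0 // mul1r => /eqP.
  by rewrite (eq_prim_root_expr zn) !modn_small // => /eqP/val_inj->.
have wn : w ^+ n = 1.
  by rewrite /w exprMn exprVn !(exprAC _ _ n) (prim_expr_order zn) !expr1n invr1 mulr1.
by apply: (mulfI w1); rewrite -subrX1 wn subrr mulr0n mulr0.
Qed.

(** For [D k] with diagonal entries [z^(k a)], averaging multiplies [G a b] by the mean over [k] of
    [z^(k (a - b))], which is 1 on the diagonal and 0 off it. *)
Lemma pinching (R : realType) (d : nat) : (0 < d)%N ->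
  exists2 D : 'I_d -> 'M[R[i]]_d, forall k, D k \is unitarymx &
    forall G : 'M[R[i]]_d, d%:R^-1 *: \sum_(k < d) (D k *m G *m (D k)^t*) =
                           diag_mx (\row_j G j j).
Proof.
move=> d0; have [z zn] := exists_prim_root R[i] d0.
pose D (k : 'I_d) : 'M[R[i]]_d := diag_mx (\row_a z ^+ (k * a)).
have dN0 : d%:R != 0 :> R[i] by rewrite pnatr_eq0 -lt0n.
have adjD k : (D k)^t* = diag_mx (\row_a Num.conj (z ^+ (k * a))).
  by rewrite /D tr_diag_mx map_diag_mx; congr diag_mx; apply/rowP=> a; rewrite !mxE.
have z1 k : z ^+ k * Num.conj (z ^+ k) = 1.
  rewrite -normCK normrX; have -> : `|z| = 1; last by rewrite !expr1n.
  apply/eqP; rewrite -(@pexpr_eq1 _ _ d) //; apply/eqP.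
  by rewrite -normrX (prim_expr_order zn) normr1.
exists D => [k|G].
  apply/unitarymxP; rewrite adjD /D; apply/matrixP=> a b.
  rewrite mul_diag_mx !mxE; case: (a == b); last by rewrite !mulr0n mulr0.
  by rewrite !mulr1n z1.
apply/matrixP=> a b; rewrite mxE summxE.
have e (k : 'I_d) : (D k *m G *m (D k)^t*) a b =
    G a b * (z ^+ (k * a) * Num.conj (z ^+ (k * b))).
  by rewrite adjD /D mul_diag_mx mul_mx_diag !mxE; ring.
under eq_bigr => k _ do rewrite e.
rewrite -mulr_sumr (sum_prim_root_expr _ _ zn) !mxE.
by case: (eqVneq a b) => [->|_]; rewrite ?mulr1n ?mulr0n ?mulr0 // mulrC mulfK.
Qed.

(** * Scalar inequalities *)

Section Scalar.
Context {R : realType}.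
Implicit Types (x y q : R).

(** Young's inequality for [y] and [x^(q - 1)] with exponents [q] and [q / (q - 1)]; the case
    [q = 1] is separate, its conjugate exponent being infinite. *)
Lemma powR_tangent x y q : 0 <= x -> 0 <= y -> 1 <= q ->
  x `^ q + q * x `^ (q - 1) * (y - x) <= y `^ q.
Proof.
move=> x0 y0; rewrite le_eqVlt => /predU1P[<-|q1].
  by rewrite subrr powRr0 !powRr1 //; lra.
have q0 : 0 < q by apply: lt_trans q1.
have q10 : 0 < q - 1 by rewrite subr_gt0.
have qN0 := lt0r_neq0 q0; have q1N0 := lt0r_neq0 q10.
have conj : q^-1 + (q / (q - 1))^-1 = 1 by rewrite invf_div mulrBl divff // mul1r addrC subrK.
have := conjugate_powR y0 (powR_ge0 x (q - 1)) q0 (divr_gt0 q0 q10) conj.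
rewrite -powRrM (_ : (q - 1) * (q / (q - 1)) = q); last by rewrite mulrC divfK.
rewrite invf_div => /(ler_wpM2l (ltW q0)).
have -> : q * (y `^ q / q + x `^ q * ((q - 1) / q)) = y `^ q + (q - 1) * x `^ q.
  by field.
rewrite -(mulr_powRB1 x0 q0); lra.
Qed.

Lemma powR_le_nonpos x y q : 0 < x -> x <= y -> q <= 0 -> y `^ q <= x `^ q.
Proof.
move=> x0 xy q0; have y0 := lt_le_trans x0 xy.
rewrite -[q]opprK !(powRN _ (- q)) lef_pV2 ?posrE ?powR_gt0 //.
by apply: ge0_ler_powR; rewrite ?nnegrE ?oppr_ge0 // ltW.
Qed.

(** The left side regularizes [x^s]: the shift keeps the base of the nonpositive power positive. *)
Lemma powR_shift_le x e s : 0 <= x -> 0 < e -> 0 < s -> s <= 1 ->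
  x * (x + e) `^ (s - 1) <= x `^ s.
Proof.
move=> x0 e0 s0 s1; have [->|xN0] := eqVneq x 0; first by rewrite mul0r powR_ge0.
have xp : 0 < x by rewrite lt_neqAle eq_sym xN0.
rewrite -(mulr_powRB1 x0 s0) ler_wpM2l // powR_le_nonpos //; first by rewrite lerDl ltW.
by rewrite subr_le0.
Qed.

(** The middle term is [(x + e)^s = x (x + e)^(s - 1) + e (x + e)^(s - 1)], whose last summand is at
    most [e^s]. *)
Lemma powR_shift_ge x e s : 0 <= x -> 0 < e -> 0 < s -> s <= 1 ->
  x `^ s <= x * (x + e) `^ (s - 1) + e `^ s.
Proof.
move=> x0 e0 s0 s1; have xe : 0 < x + e by rewrite ltr_wpDl.
apply: (@le_trans _ _ ((x + e) `^ s)).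
  by apply: ge0_ler_powR; rewrite ?nnegrE ?(ltW s0) ?(ltW xe) // lerDl ltW.
rewrite -(mulr_powRB1 (ltW xe) s0) mulrDl lerD2l -(mulr_powRB1 (ltW e0) s0).
rewrite ler_wpM2l ?(ltW e0) // powR_le_nonpos //; first by rewrite lerDr.
by rewrite subr_le0.
Qed.

End Scalar.

(** * Inequalities between prefix sums *)

Section PrefixSums.
Context {R : realDomainType} {d : nat}.

(* Summation by parts. *)
Lemma prefix_sum_weighted (c z : 'I_d -> R) :
  (forall i, 0 <= c i) -> (forall i j : 'I_d, (i <= j)%N -> c j <= c i) ->
  (forall k : nat, 0 <= \sum_(l < d | (l < k)%N) z l) ->
  forall k : nat, 0 <= \sum_(l < d | (l < k)%N) c l * z l.
Proof.
move=> c0 cdec z0.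
(* The induction carries an arbitrary nonnegative lower bound [a] of the first [k] weights; [a = 0]
   is the claim. *)
suff H k : forall a, 0 <= a -> (forall l : 'I_d, (l < k)%N -> a <= c l) ->
    a * \sum_(l < d | (l < k)%N) z l <= \sum_(l < d | (l < k)%N) c l * z l.
  by move=> k; have := H k 0 (lexx _) (fun l _ => c0 l); rewrite mul0r.
elim: k => [|k IHk] a a0 ac; first by rewrite !big_pred0 ?mulr0.
have [kd|dk] := ltnP k d; last first.
  have eqk (F : 'I_d -> R) : \sum_(l < d | (l < k.+1)%N) F l = \sum_(l < d | (l < k)%N) F l.
    apply: eq_bigl => l; have lk := leq_trans (ltn_ord l) dk.
    by rewrite lk ltnS ltnW.
  by rewrite !eqk; apply: IHk => // l lk; apply: ac; exact: ltnW.
pose o := Ordinal kd.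
have recr (F : 'I_d -> R) :
    \sum_(l < d | (l < k.+1)%N) F l = F o + \sum_(l < d | (l < k)%N) F l.
  rewrite (bigD1 o) //=; congr (_ + _); apply: eq_bigl => l.
  by rewrite ltnS -val_eqE /= andbC -ltn_neqAle.
(* Nonnegativity of the prefix sum allows raising [a] to the last weight [c o], which bounds the
   earlier ones from below. *)
apply: (@le_trans _ _ (c o * \sum_(l < d | (l < k.+1)%N) z l)).
  by rewrite ler_wpM2r // ac //= ltnS.
rewrite !recr mulrDr lerD2l IHk // => l lk; apply: cdec; exact: ltnW.
Qed.

(** Pairs of indices below [k] contribute equally to both sides by symmetry of [m]; in the other
    terms [j < k <= l], so [t j <= t l]. *)
Lemma prefix_sum_sym (m : 'I_d -> 'I_d -> R) (t : 'I_d -> R) (k : nat) :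
  (forall i j, m i j = m j i) -> (forall i j, 0 <= m i j) ->
  (forall i j : 'I_d, (i <= j)%N -> t i <= t j) ->
  \sum_(j < d | (j < k)%N) t j * (\sum_l m j l) <=
  \sum_(j < d | (j < k)%N) \sum_l t l * m j l.
Proof.
move=> msym m0 tinc.
have split (F : 'I_d -> 'I_d -> R) : \sum_(j < d | (j < k)%N) \sum_l F j l =
    \sum_(j < d | (j < k)%N) \sum_(l < d | (l < k)%N) F j l +
    \sum_(j < d | (j < k)%N) \sum_(l < d | ~~ (l < k)%N) F j l.
  by rewrite -big_split; apply: eq_bigr => j _; exact: bigID.
under eq_bigr => j _ do rewrite mulr_sumr.
rewrite (split (fun j l => t j * m j l)) (split (fun j l => t l * m j l)); apply: lerD.
  rewrite exchange_big /= le_eqVlt; apply/orP; left; apply/eqP.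
  by apply: eq_bigr => j _; apply: eq_bigr => l _; rewrite msym.
apply: ler_sum => j jk; apply: ler_sum => l; rewrite -leqNgt => kl.
by rewrite ler_wpM2r // tinc // (leq_trans (ltnW jk)).
Qed.

End PrefixSums.

(** * Prefix sums of eigenvalues *)

Section Main.
Context {R : realType} {d : nat}.
Implicit Types (A B G P Q U X Y : 'M[R[i]]_d) (f g : 'I_d -> R).

Lemma loewner_le_specmx U f g : (forall l, f l <= g l) ->
  loewner_le (specmx U f) (specmx U g).
Proof.
move=> fg; rewrite /loewner_le specmxB; apply: psd_specmx => l.
by rewrite subr_ge0.
Qed.

Lemma loewner_le_conj U X Y :
  loewner_le X Y -> loewner_le (U *m X *m U^t*) (U *m Y *m U^t*).
Proof. by move=> /(loewner_le_congr (U^t*)); rewrite trmxCK. Qed.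

Lemma conj_specmx U f : U \is unitarymx -> U *m specmx U f *m U^t* = rdiag f.
Proof.
by move=> Uu; rewrite /specmx !mulmxA (unitarymxP Uu) mul1mx mulmxtVK.
Qed.

Lemma Re_rdiag f j : complex.Re (rdiag f j j) = f j.
Proof. by rewrite !mxE eqxx. Qed.

Lemma diag_mx_hermsym G : G^t* = G ->
  diag_mx (\row_j G j j) = rdiag (fun j => complex.Re (G j j)).
Proof.
move=> hG; rewrite /rdiag; congr diag_mx; apply/rowP=> j.
by rewrite !mxE; exact: hermsym_diag.
Qed.

Lemma Re_herm_rdiag_herm X f j : X^t* = X ->
  complex.Re ((X *m rdiag f *m X) j j) = \sum_l f l * sqnorm (X j l).
Proof.
move=> hX; rewrite mxE (_ : \sum_l _ = (\sum_l f l * sqnorm (X j l))%:C) //.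
rewrite rmorph_sum; apply: eq_bigr => l _.
rewrite mul_mx_diag !mxE rmorphM /= sqnormE (hermsym_entry l j hX).
by rewrite mulrAC mulrC (mulrC (X j l)).
Qed.

Lemma sqnorm_herm X i j : X^t* = X -> sqnorm (X i j) = sqnorm (X j i).
Proof.
move=> hX; rewrite (hermsym_entry i j hX); case: (X j i) => a b.
by rewrite /sqnorm /= sqrrN.
Qed.

(** In the eigenbasis given by [U], [C] becomes a Hermitian [M]; the diagonals of [T B] and [C T C]
    become the sums over [l] of [t j |M j l|^2] and [t l |M j l|^2], which [prefix_sum_sym]
    compares. *)
Lemma prefix_trace_le U P (sg a : 'I_d -> R) (p e : R) (k : nat) :
  U \is unitarymx -> P \is unitarymx ->
  (forall j, 0 <= sg j) -> (forall j, 0 <= a j) ->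
  (forall i j : 'I_d, (i <= j)%N -> sg j <= sg i) -> 1 <= p -> 0 < e ->
  loewner_le (specmx P (fun j => a j `^ p)) (specmx U sg) ->
  \sum_(j < d | (j < k)%N) (sg j + e) `^ (p^-1 - 1) *
     complex.Re ((U *m specmx P (fun j => a j `^ p) *m U^t*) j j) <=
  \sum_(j < d | (j < k)%N) complex.Re ((U *m specmx P a *m U^t*) j j).
Proof.
move=> Uu Pu sg0 a0 sg_dec p1 e0 L.
have p0 : 0 < p by exact: lt_le_trans p1.
have s0 : 0 < p^-1 by rewrite invr_gt0.
have s1 : p^-1 <= 1 by rewrite invf_le1.
pose b j := a j `^ p; have b0 j : 0 <= b j by exact: powR_ge0.
pose t j := (sg j + e) `^ (p^-1 - 1).
have L1 : loewner_le (specmx P (fun j => b j + e)) (specmx U (fun j => sg j + e)).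
  rewrite -!specmxD (specmx_cst _ Pu) (specmx_cst _ Uu).
  exact: loewner_le_addl.
have hq : -1 <= p^-1 - 1 <= 0 by apply/andP; split; lra.
have L2 := loewner_heinz_neg Pu Uu (fun j => ltr_wpDl (b0 j) e0)
  (fun j => ltr_wpDl (sg0 j) e0) hq L1.
pose C := specmx P (fun j => a j `^ (p / 2)).
have hC : C^t* = C by exact: specmx_adj.
have CC : C *m C = specmx P b.
  rewrite /C (specmxM _ _ Pu); apply: eq_specmx => j.
  rewrite -powRD /b; first by congr (_ `^ _); lra.
  by have -> : p / 2 + p / 2 = p; [lra | rewrite (gt_eqF p0)].
(* The two matrices left after the Loewner-Heinz bound share the eigenbasis [P], and
   [b (b + e)^(p^-1 - 1) <= b^(p^-1) = a]. *)
have L3 : loewner_le (C *m specmx U t *m C) (specmx P a).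
  have L2C := loewner_le_congr C L2; rewrite hC in L2C.
  apply: (loewner_le_trans L2C).
  rewrite /C !(specmxM _ _ Pu); apply: loewner_le_specmx => j.
  rewrite mulrAC -powRD; last by have -> : p / 2 + p / 2 = p; [lra | rewrite (gt_eqF p0)].
  have -> : p / 2 + p / 2 = p by lra.
  apply: le_trans (powR_shift_le (b0 j) e0 s0 s1) _.
  by rewrite /b -powRrM mulfV ?gt_eqF // powRr1.
clearbody C.
pose M := U *m C *m U^t*.
have hM : M^t* = M by rewrite /M 2!adj_mulmx trmxCK hC mulmxA.
have ME : U *m (C *m specmx U t *m C) *m U^t* = M *m rdiag t *m M.
  by rewrite /M /specmx !mulmxA.
have MM : U *m specmx P b *m U^t* = M *m rdiag (fun=> 1) *m M.
  rewrite rdiag_cst rmorph1 mulmx1 -CC /M !mulmxA.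
  by rewrite (mulmxKtV _ Uu (erefl d)).
apply: (@le_trans _ _ (\sum_(j < d | (j < k)%N) \sum_l t l * sqnorm (M j l))); last first.
  apply: ler_sum => j _; rewrite -(Re_herm_rdiag_herm t j hM) -ME.
  exact: loewner_le_diag (loewner_le_conj U L3).
rewrite (eq_bigr (fun j => t j * \sum_l sqnorm (M j l))) => [|j _].
  apply: prefix_sum_sym => [i j|i j|i j ij].
  - exact: sqnorm_herm.
  - exact: sqnorm_ge0.
  - apply: powR_le_nonpos; first by rewrite ltr_wpDl.
      by rewrite lerD2r sg_dec.
    by case/andP: hq.
rewrite -/b MM (Re_herm_rdiag_herm _ _ hM); congr (_ * _).
by apply: eq_bigr => l _; rewrite mul1r.
Qed.

Lemma Re_conj_sum (I : Type) (r : seq I) (F : I -> 'M[R[i]]_d) U j :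
  complex.Re ((U *m (\sum_(k <- r) F k) *m U^t*) j j) =
  \sum_(k <- r) complex.Re ((U *m F k *m U^t*) j j).
Proof.
elim: r => [|k r IHr]; first by rewrite !big_nil mulmx0 mul0mx mxE.
by rewrite !big_cons mulmxDr mulmxDl mxE ReD IHr.
Qed.

(** Once [prefix_trace_le] is summed over [k], its left side involves only [U S U^*], which is
    diagonal with entries [sg]. *)
Lemma prefix_powR_le m (A : 'I_m -> 'M[R[i]]_d) U (sg : 'I_d -> R) (p : R) (n : nat) :
  (forall k, psdmx (A k)) -> U \is unitarymx -> (forall j, 0 <= sg j) ->
  (forall i j : 'I_d, (i <= j)%N -> sg j <= sg i) -> 1 <= p ->
  \sum_(k < m) psdpow (A k) p = specmx U sg ->
  \sum_(j < d | (j < n)%N) sg j `^ p^-1 <=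
  \sum_(j < d | (j < n)%N) complex.Re ((U *m (\sum_(k < m) A k) *m U^t*) j j).
Proof.
move=> hA Uu sg0 sg_dec p1 SE.
have p0 : 0 < p by exact: lt_le_trans p1.
have s0 : 0 < p^-1 by rewrite invr_gt0.
have s1 : p^-1 <= 1 by rewrite invf_le1.
have psdB k : psdmx (psdpow (A k) p).
  have [P [a [Pu a0 ->]]] := psdmx_specmx (hA k).
  by rewrite (psdpow_specmx _ _ Pu); apply: psd_specmx => j; exact: powR_ge0.
have BS k : loewner_le (psdpow (A k) p) (specmx U sg).
  rewrite /loewner_le -SE (bigD1 k) //= addrC addrK.
  by apply: psdmx_sum.
have eps e : 0 < e -> \sum_(j < d | (j < n)%N) (sg j + e) `^ (p^-1 - 1) * sg j <=
    \sum_(j < d | (j < n)%N) complex.Re ((U *m (\sum_(k < m) A k) *m U^t*) j j).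
  move=> e0; rewrite [leRHS](eq_bigr _ (fun j _ => Re_conj_sum _ A U j)) exchange_big /=.
  have -> : \sum_(j < d | (j < n)%N) (sg j + e) `^ (p^-1 - 1) * sg j =
      \sum_(k < m) \sum_(j < d | (j < n)%N) (sg j + e) `^ (p^-1 - 1) *
        complex.Re ((U *m psdpow (A k) p *m U^t*) j j).
    rewrite exchange_big; apply: eq_bigr => j _ /=.
    by rewrite -mulr_sumr -Re_conj_sum SE (conj_specmx _ Uu) Re_rdiag.
  apply: ler_sum => k _; have [P [a [Pu a0 AE]]] := psdmx_specmx (hA k).
  have L := BS k; rewrite AE (psdpow_specmx _ _ Pu) in L *.
  exact: prefix_trace_le.
apply/ler_addgt0Pr => e e0.
(* Chosen so that [h^(p^-1) = e / (d + 1)]: the at most [d] error terms then add up to at most [e],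
   and the denominator is nonzero even for [d = 0]. *)
pose h := (e / d.+1%:R) `^ p.
have ed0 : 0 < e / d.+1%:R by rewrite divr_gt0 ?ltr0n.
have h0 : 0 < h by exact: powR_gt0.
apply: le_trans (lerD (eps h h0) (lexx e)).
have hs : h `^ p^-1 = e / d.+1%:R by rewrite /h -powRrM mulfV ?gt_eqF // powRr1 // ltW.
apply: (@le_trans _ _ (\sum_(j < d | (j < n)%N)
    ((sg j + h) `^ (p^-1 - 1) * sg j + e / d.+1%:R))).
  apply: ler_sum => j _; rewrite -hs (mulrC _ (sg j)).
  exact: powR_shift_ge.
rewrite big_split lerD2l /= sumr_const -(mulr_natr (e / _)) -mulrA ger_pMr //.
rewrite mulrC ler_pdivrMr ?ltr0n // mul1r ler_nat.
by rewrite (leq_trans (max_card _)) // card_ord.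
Qed.

(** The tangent bound holds on the spectrum of [specmx Q y], hence between matrices; its lower side
    is affine in [specmx Q y], so its diagonal entries are affine in those of the conjugate. *)
Lemma specmx_tangent_le U Q (y : 'I_d -> R) (x q : R) j :
  U \is unitarymx -> Q \is unitarymx ->
  (forall l, 0 <= y l) -> 0 <= x -> 1 <= q ->
  x `^ q + q * x `^ (q - 1) * (complex.Re ((U *m specmx Q y *m U^t*) j j) - x) <=
  complex.Re ((U *m specmx Q (fun l => y l `^ q) *m U^t*) j j).
Proof.
move=> Uu Qu y0 x0 q1; set c := q * x `^ (q - 1).
have L : loewner_le (specmx Q (fun l => x `^ q + c * (y l - x)))
                    (specmx Q (fun l => y l `^ q)).
  by apply: loewner_le_specmx => l; exact: powR_tangent.
apply: le_trans (loewner_le_diag j (loewner_le_conj U L)).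
rewrite (@eq_specmx _ _ Q (fun l => x `^ q + c * (y l - x))
  (fun l => (x `^ q - c * x) + c * y l)) => [|l]; last by ring.
rewrite -specmxD (specmx_cst _ Qu) -(specmxM (fun=> c) y Qu) (specmx_cst _ Qu).
rewrite mul_scalar_mx mulmxDr mulmxDl -scalemxAr -scalemxAl.
rewrite mul_mx_scalar -scalemxAl (unitarymxP Uu); move: (_ *m _ *m _) => N.
have -> : ((x `^ q - c * x)%:C *: 1%:M + c%:C *: N) j j =
    (x `^ q - c * x)%:C + c%:C * N j j by rewrite !mxE eqxx mulr1.
by rewrite ReD ReZ /= mulrBr addrA addrAC.
Qed.

End Main.

(** * Assembly of the unitary matrices *)

Theorem corollary2p2 (R : realType) (d m : nat) (hd : (1 <= d)%N)
    (hm : (1 <= m)%N) (A : 'I_m -> 'M[R[i]]_d) (p r : R)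
    (hA : forall k, psdmx (A k)) (hp : 1 <= p) (hr : 1 <= r) :
  exists V : 'I_d -> 'M[R[i]]_d,
    (forall i, V i \is unitarymx) /\
    loewner_le
      (psdpow (\sum_(k < m) psdpow (A k) p) r)
      (d%:R^-1 *: \sum_(i < d)
         (V i *m psdpow (\sum_(k < m) A k) (p * r) *m (V i) ^t*)).
Proof.
have p0 : 0 < p by exact: lt_le_trans hp.
have q1 : 1 <= p * r by rewrite (le_trans hp) // ler_peMr // ltW.
have q0 : 0 <= p * r := le_trans ler01 q1.
set S := \sum_(k < m) psdpow (A k) p; set Y := \sum_(k < m) A k.
have psdS : psdmx S.
  apply: psdmx_sum => k _; have [P [a [Pu a0 ->]]] := psdmx_specmx (hA k).
  by rewrite (psdpow_specmx _ _ Pu); apply: psd_specmx => j; exact: powR_ge0.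
have psdY : psdmx Y := psdmx_sum _ (fun k _ => hA k).
have [U [sg [Uu sg0 sg_dec SE]]] := psdmx_specmx_sorted psdS.
have [Q [y [Qu y0 YE]]] := psdmx_specmx psdY.
pose H := U *m psdpow Y (p * r) *m U^t*.
have hH : H^t* = H.
  by rewrite /H YE (psdpow_specmx _ _ Qu) 2!adj_mulmx trmxCK specmx_adj mulmxA.
pose x j := sg j `^ p^-1; have x0 j : 0 <= x j by exact: powR_ge0.
have x_dec (i j : 'I_d) : (i <= j)%N -> x j <= x i.
  move=> ij; apply: ge0_ler_powR; rewrite ?nnegrE ?sg0 ?sg_dec //.
  by rewrite invr_ge0 ltW.
have xE j : x j `^ (p * r) = sg j `^ r.
  by rewrite /x -powRrM mulKf // gt_eqF.
(* The slope at [x j] of the tangent to [t^(p r)]; these slopes are nonnegative and nonincreasing in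
   [j], as summation by parts requires. *)
pose c j := p * r * x j `^ (p * r - 1).
have [||W Wu WH] := @horn_dominate R d (fun j => sg j `^ r) H _ hH.
- move=> i j ij; apply: ge0_ler_powR; rewrite ?nnegrE ?sg0 ?sg_dec //.
  by rewrite (le_trans ler01).
- move=> n; rewrite -subr_ge0 -sumrB.
  pose z j := complex.Re ((U *m Y *m U^t*) j j) - x j.
  (* By the tangent inequality at [x j], each difference is at least [c j] times [z j]. *)
  apply: (@le_trans _ _ (\sum_(j < d | (j < n)%N) c j * z j)).
    apply: prefix_sum_weighted => [j|i j ij|k].
    + exact: mulr_ge0 q0 (powR_ge0 _ _).
    + by apply: (ler_wpM2l q0); apply: ge0_ler_powR; rewrite ?nnegrE ?x0 ?x_dec ?subr_ge0.
    + by rewrite sumrB subr_ge0; apply: prefix_powR_le.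
  apply: ler_sum => j _; rewrite lerBrDl -xE /z /H YE (psdpow_specmx _ _ Qu).
  exact: specmx_tangent_le.
have [D Du DE] := pinching R hd.
pose G := W *m H *m W^t*.
have hG : G^t* = G by rewrite /G 2!adj_mulmx trmxCK hH mulmxA.
pose V k := U^t* *m D k *m W *m U.
have VE k : V k *m psdpow Y (p * r) *m (V k)^t* =
    U^t* *m (D k *m G *m (D k)^t*) *m U.
  by rewrite /V /G /H 3!adj_mulmx trmxCK !mulmxA.
exists V; split=> [k|].
  have U'u : U^t* \is unitarymx by apply/unitarymxP; rewrite trmxCK (unitary_adjK Uu).
  exact: (mul_unitarymx (mul_unitarymx (mul_unitarymx U'u (Du k)) Wu) Uu).
(* Conjugation by [U] factors out of the average, which pinches [G] to its diagonal; both sides are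
   then diagonal in the eigenbasis of [S] and compare entrywise. *)
rewrite (eq_bigr _ (fun k _ => VE k)) -mulmx_suml -mulmx_sumr scalemxAl scalemxAr DE.
rewrite (diag_mx_hermsym hG) SE (psdpow_specmx _ _ Uu) -/(specmx U _).
exact: (loewner_le_specmx U WH).
Qed.
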